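(* Let $\varphi$ be an Orlicz function satisfying the $\Delta_2^\infty$-condition and let $w$ be a weight function on $[0,1]$. Then the set $\Lambda_{\varphi,w}[0,1]\setminus\bigcup_{w\ll v}\Lambda_{\varphi,v}[0,1]$ is empty, where the union is taken over all weight functions $v$ on $[0,1]$ with $w\ll v$.
   Context: The interval $[0,1]$ carries Lebesgue measure $m$. $L_0$ is the space of real Lebesgue measurable functions on $[0,1]$ modulo a.e. equality. For $f\in L_0$, $d_f(\lambda)=m(\{t:|f(t)|>\lambda\})$ for $\lambda>0$, and $f^*(t)=\inf\{\lambda>0:d_f(\lambda)\le t\}$ for $t\ge0$ (with $\inf\varnothing=\infty$). An Orlicz function is a convex function $\varphi:[0,\infty)\to[0,\infty)$ with $\varphi(0)=0=\lim_{u\to0}\varphi(u)$ and $\varphi(u)>0$ for $u>0$ (put $\varphi(\infty)=\infty$). It satisfies the $\Delta_2^\infty$-condition if there are $K>2$ and $u_0\ge0$ with $\varphi(2u)\le K\varphi(u)$ for all $u\ge u_0$. A weight function on $[0,1]$ is a positive, decreasing (i.e. nonincreasing) integrable function $w:(0,1]\to(0,\infty)$. For weight functions $w,v$ write $w\ll v$ if $\lim_{t\to0^+}\frac{W(t)}{V(t)}=0$, where $W(t)=\int_0^t w$ and $V(t)=\int_0^t v$. The modular is $\rho_{\varphi,w}(f)=\int_0^1\varphi(f^*(t))w(t)\,dt$, and the Orlicz-Lorentz space is $\Lambda_{\varphi,w}[0,1]=\{f\in L_0:\rho_{\varphi,w}(kf)<\infty\text{ for some }k>0\}$. *)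

(* Defs.v *)
From HB Require Import structures.
From mathcomp Require Import all_boot all_order all_algebra.
From mathcomp Require Import all_classical all_reals all_analysis.
Set Implicit Arguments.
Unset Strict Implicit.
Unset Printing Implicit Defensive.
Import Order.TTheory GRing.Theory Num.Theory.
Import numFieldNormedType.Exports.

Local Open Scope classical_set_scope.
Local Open Scope ring_scope.

(* The set R carrying the sigma-algebra of all Lebesgue measurable sets; the
   library's default sigma-algebra on R is the (smaller) Borel one. The
   corresponding measure is completed_lebesgue_measure. *)
Notation lebesgueR R := (caratheodory_type (mu_ext (@wlength R idfun))).
Local Notation m := completed_lebesgue_measure.

Lemma lebesgueR_measurable01 (R : realType) :
  measurable (`[0, 1]%classic : set (lebesgueR R)).
Proof. by apply: sub_caratheodory; exact: (@measurable_itv R `[0, 1]). Qed.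

Section orlicz_lorentz.
Variable R : realType.
Implicit Types (phi w v : R -> R) (f : lebesgueR R -> R).

(* Functions are total on R, but since the quotient is with respect to the
   restriction of m to [0, 1], their values outside [0, 1] are irrelevant. *)
Definition L0 :=
  {mfun_ (mrestr (@m R) (@lebesgueR_measurable01 R)),
    lebesgueR R >-> measurableTypeR R}.

Definition distribution_fun f (l : R) : \bar R :=
  m [set t | `[0, 1]%classic t /\ l < `|f t|].

Definition rearrangement f (t : R) : \bar R :=
  ereal_inf [set l%:E | l in
    [set l : R | 0 < l /\ (distribution_fun f l <= t%:E)%E]].

(* Nonnegativity of phi on [0, +oo[ follows from the second and fourth
   clauses; the values of phi on negative reals are irrelevant. *)
Definition orlicz_function phi :=
  [/\ @convex_function R R^o `[0, +oo[%classic phi,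
      phi 0 = 0,
      phi u @[u --> 0^'+] --> 0 &
      forall u, 0 < u -> 0 < phi u].

Definition Delta2_infty phi :=
  exists K u0 : R, [/\ 2 < K, 0 <= u0 &
    forall u, u0 <= u -> phi (2 * u) <= K * phi u].

(* A weight is a function on ]0, 1]; its values elsewhere are irrelevant. *)
Definition weight w :=
  [/\ {in `]0, 1], forall t, 0 < w t},
      {in `]0, 1] &, nonincreasing_fun w} &
      (@m R).-integrable `]0, 1]%classic (EFin \o w)].

Definition primitive w (t : R) : R := \int[m]_(s in `]0, t]%classic) w s.

Definition weight_ll w v :=
  (primitive w t / primitive v t) @[t --> 0^'+] --> 0.

(* er_map extends phi by phi(+oo) = +oo; the rearrangement is nonnegative, so
   the value at -oo plays no role. *)
Definition modular phi w f : \bar R :=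
  (\int[m]_(t in `]0%R, 1%R]%classic)
     (er_map phi (rearrangement f t) * (w t)%:E))%E.

(* The modular does not depend on the representative of the class f. *)
Definition orlicz_lorentz phi w : set L0 :=
  [set f : L0 | exists2 k : R, 0 < k &
    (modular phi w (fun t => (k * aqEqMfun_to_fun f t)%R) < +oo)%E].

End orlicz_lorentz.

(* Main.v *)
Require Import Defs.
From HB Require Import structures.
From mathcomp Require Import all_boot all_order all_algebra.
From mathcomp Require Import all_classical all_reals all_analysis.
From mathcomp Require Import measurable_realfun.
Set Implicit Arguments.
Unset Strict Implicit.
Unset Printing Implicit Defensive.
Import Order.TTheory GRing.Theory Num.Theory.
Import numFieldNormedType.Exports.

Local Open Scope classical_set_scope.
Local Open Scope ring_scope.

Local Notation m := completed_lebesgue_measure.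

(** Let [f] lie in the Orlicz-Lorentz space of [w], with [modular phi w (k f)]
finite.  A weight [v >> w] whose space still contains [f] is found in the form
[v = w h], where [h] is nonincreasing and tends to infinity at 0.  For such a
[v] the relation [w << v] is automatic: [h >= h t] on ]0, t], so the primitives
satisfy [V t >= h t * W t], and [W / V <= 1 / h] tends to 0 ([weight_ll_mul]).

It remains to choose [h] growing slowly enough that [v] is integrable and
[modular phi v (k f)] is finite.  Both hold as soon as [F h] is integrable,
where [F = (1 + phi ((k f)^* )) w] is integrable by assumption.  This is the
classical fact that an integrable function stays integrable after
multiplication by some unbounded factor ([exists_blowup_multiplier]): the
integral of [F] over ]0, t] tends to 0 with [t], so there are points [t_ n > 0]
for which these integrals are at most [2^-(n+1)]; if [h] is one plus the number
of [n] (below a cutoff depending on the argument) with [t <= t_ n], then the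
integral of [F h] is at most that of [F] plus [\sum_n 2^-(n+1)].

Measurability of [F] comes from monotonicity: an Orlicz function is
nondecreasing, so [phi ((k f)^* )] is nonincreasing. *)

(** * The composition of an Orlicz function with a rearrangement *)

(** For [0 <= x <= y], the point [x] is the convex combination of [y] and 0 with
coefficient [x / y], so convexity and [phi 0 = 0] bound [phi x] by
[(x / y) * phi y]. *)
Lemma orlicz_nondecreasing (R : realType) (phi : R -> R) :
  orlicz_function phi ->
  {in `[0, +oo[ &, {homo phi : x y / x <= y}}.
Proof.
move=> [phi_cvx phi0 _ phi_gt0] x y; rewrite !in_itv/= !andbT => x0 y0 xy.
have [y_eq0|y_neq0] := eqVneq y 0.
  by have -> : x = y by apply/eqP; rewrite eq_le xy y_eq0.
have y_gt0 : 0 < y by rewrite lt_neqAle eq_sym y_neq0.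
have xy_ge0 : 0 <= x / y by rewrite divr_ge0.
have xy_le1 : x / y <= 1 by rewrite ler_pdivrMr// mul1r.
pose t := Itv01 xy_ge0 xy_le1.
have convE : conv t (y : convex_lmodType R^o) 0 = x.
  by apply: (etrans (convRE y 0 t)); rewrite /= mulr0 addr0 divfK.
have := @phi_cvx t y 0.
rewrite !inE/= !in_itv/= !andbT lexx => /(_ y0 isT).
rewrite convE convRE phi0 mulr0 addr0 => /le_trans; apply.
by rewrite ler_piMl// ltW// phi_gt0.
Qed.

Lemma er_map_orlicz_ge0 (R : realType) (phi : R -> R) (x : \bar R) :
  orlicz_function phi -> (0 <= x)%E -> (0 <= er_map phi x)%E.
Proof.
move=> [_ phi0 _ phi_gt0]; case: x => [r| |]//=; rewrite !lee_fin.
by rewrite le_eqVlt => /predU1P[<-|/phi_gt0/ltW//]; rewrite phi0.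
Qed.

Lemma er_map_orlicz_le (R : realType) (phi : R -> R) (x y : \bar R) :
  orlicz_function phi -> (0 <= x)%E -> (x <= y)%E ->
  (er_map phi x <= er_map phi y)%E.
Proof.
move=> phiO; case: x => [r| |]; case: y => [s| |]//=; rewrite ?leey//.
rewrite !lee_fin => r0 rs.
by apply: orlicz_nondecreasing; rewrite ?in_itv/= ?andbT ?(le_trans r0).
Qed.

Lemma rearrangement_ge0 (R : realType) (f : lebesgueR R -> R) (t : R) :
  (0 <= rearrangement f t)%E.
Proof. by apply: le_ereal_inf_tmp => _ [l [/ltW l0 _] <-]; rewrite lee_fin. Qed.

Lemma rearrangement_nonincreasing (R : realType) (f : lebesgueR R -> R) :
  nonincreasing_fun (rearrangement f).
Proof.
move=> s t st; apply: ereal_inf_le_tmp => _ [l [l0 fl] <-].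
by exists l => //; split => //; rewrite (le_trans fl)// lee_fin.
Qed.

(** * Monotone functions and initial integrals *)

Lemma lebesgueR_measurable_itv (R : realType) (i : interval R) :
  measurable ([set` i] : set (lebesgueR R)).
Proof. by apply: sub_caratheodory; exact: (@measurable_itv R i). Qed.

Lemma lebesgueR_is_interval_measurable (R : realType) (I : set R) :
  is_interval I -> measurable (I : set (lebesgueR R)).
Proof.
by move=> itvI; apply: sub_caratheodory; exact: is_interval_measurable.
Qed.
#[local] Hint Extern 0 (measurable _) => exact: lebesgueR_measurable_itv : core.

(** Upper level sets of a monotone function on an interval are intervals.  Values
in the extended reals are allowed because a rearrangement may be infinite. *)
Lemma nonincreasing_itv_measurable (R : realType) (i : interval R)
    (g : lebesgueR R -> \bar R) :
  {in i &, forall x y : R, x <= y -> (g y <= g x)%E} ->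
  measurable_fun ([set` i] : set (lebesgueR R)) g.
Proof.
move=> g_ni.
apply: (measurability _ (ErealGenCInfty.measurableE R)).
move=> _ [_ [r ->] <-].
apply: lebesgueR_is_interval_measurable => s t [si _] [ti rt] u /andP[su ut].
have ui : u \in i by apply: (@interval_is_interval _ i s t) => //=; rewrite su.
split; first exact: ui.
by move: rt; rewrite /= !in_itv/= !andbT => /le_trans; apply; exact: g_ni.
Qed.

(** Dominated convergence: the truncations of [F] to the sets [I n] are bounded
by [`|F|] and are eventually 0 at each point of [D]. *)
Lemma cvg_integral_vanishing d (T : measurableType d) (R : realType)
    (mu : {measure set T -> \bar R}) (D : set T) (I : nat -> set T)
    (F : T -> \bar R) :
  measurable D -> (forall n, measurable (I n)) ->
  (forall x, D x -> \forall n \near \oo, ~ I n x) ->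
  mu.-integrable D F ->
  (\int[mu]_(x in D `&` I n) F x)%E @[n --> \oo] --> 0%E.
Proof.
move=> mD mI I0 F_int.
have mF : measurable_fun D F := measurable_int mu F_int.
have mFI n : measurable_fun D (F \_ (I n)).
  apply/measurable_restrict => //.
  by apply: measurable_funS mF => //; exact: subIsetl.
have [] := @dominated_convergence _ _ R mu D mD (fun n => F \_ (I n)) (cst 0%E)
  (abse \o F) mFI.
- exact: measurable_cst.
- apply: aeW => x /I0 Ix; apply/cvg_ballP => e e0.
  near=> n; rewrite patchE memNset; first exact: ballxx.
  by near: n.
- exact: integrable_abse.
- apply: aeW => x n Dx; rewrite patchE.
  case: ifPn => _ /=; first exact: lexx.
  by rewrite normr0 abse_ge0.
move=> _ _; rewrite integral0 /=.
by under eq_fun do rewrite -integral_mkcondr.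
Unshelve. all: by end_near. Qed.

Lemma small_initial_integral (R : realType) (F : lebesgueR R -> \bar R)
    (e : R) :
  m.-integrable `]0, 1]%classic F -> 0 < e ->
  exists2 t : R, 0 < t &
    (\int[m]_(s in `]0%R, 1%R]%classic `&` `]0%R, t]%classic) F s <= e%:E)%E.
Proof.
move=> F_int e0.
pose I n : set (lebesgueR R) := `]0, n.+1%:R^-1]%classic.
have I0 x : (`]0, 1]%classic : set (lebesgueR R)) x ->
    \forall n \near \oo, ~ I n x.
  rewrite /= in_itv/= => /andP[x0 _]; near=> n.
  rewrite /I /= in_itv/= x0/= => xn.
  have : n.+1%:R^-1 < x by near: n; exact: near_infty_natSinv_lt (PosNum x0).
  by rewrite ltNge xn.
have mI n : measurable (I n) by exact: lebesgueR_measurable_itv.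
have /= := @cvg_integral_vanishing _ _ R m _ I F
  (lebesgueR_measurable_itv _) mI I0 F_int.
move=> /(_ [set y | y < e%:E]%E) [|n _ /(_ n (leqnn n)) /= /ltW Fn].
  apply: open_nbhs_nbhs; split; first exact: open_ereal_lt_ereal.
  by rewrite /= lte_fin.
by exists n.+1%:R^-1.
Unshelve. all: by end_near. Qed.

(** * The multiplier and the larger weight *)

(** The multiplier counts the points [t_ n] not less than its argument.  Only
the indices [n < K x] are counted, so that the number is finite, and [K x]
grows like [1 / x], so that every index is eventually counted as [x] tends
to 0. *)
Lemma exists_blowup_multiplier (R : realType) (F : lebesgueR R -> \bar R) :
  m.-integrable `]0, 1]%classic F -> (forall t, 0 < t <= 1 -> (0 <= F t)%E) ->
  exists h : R -> R, [/\ forall t, 1 <= h t,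
    {in `]0, 1] &, nonincreasing_fun h},
    h t @[t --> 0^'+] --> +oo &
    (\int[m]_(t in `]0%R, 1%R]%classic) (F t * (h t)%:E) < +oo)%E].
Proof.
move=> F_int F0.
have /boolp.choice[t_ /all_and2[t_gt0 int_t_]] : forall n, exists t, 0 < t /\
    (\int[m]_(s in `]0%R, 1%R]%classic `&` `]0%R, t]%classic) F s
       <= (1 / (2 ^ n.+1)%:R)%:E)%E.
  move=> n.
  have [|t t0 Ft] := @small_initial_integral R F (1 / (2 ^ n.+1)%:R) F_int.
    by rewrite divr_gt0// ltr0n expn_gt0.
  by exists t.
pose K (x : R) := (Num.truncn x^-1).+1.
pose c (x : R) := (\sum_(0 <= n < K x) (x <= t_ n)%R)%N.
have c_ni x y : 0 < x -> x <= y -> (c y <= c x)%N.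
  move=> x0 xy; have y0 : 0 < y := lt_le_trans x0 xy.
  (* A smaller argument counts more indices and passes more thresholds. *)
  have Kyx : (K y <= K x)%N by rewrite ltnS le_truncn// lef_pV2.
  rewrite /c (big_cat_nat _ Kyx)//= (leq_trans _ (leq_addr _ _))//.
  apply: leq_sum => n _; case: (leP y (t_ n)) => // ytn.
  by rewrite (le_trans xy ytn).
exists (fun x => (c x).+1%:R); split.
- by move=> x; rewrite ler1n.
- move=> x y; rewrite !in_itv/= => /andP[x0 _] _ xy.
  by rewrite ler_nat ltnS c_ni.
- apply/cvgryPge => A.
  have near_t N : \forall x \near 0^'+, forall n, (n < N)%N -> x <= t_ n.
    elim: N => [|N IH]; first by near=> x.
    near=> x => n; rewrite ltnS leq_eqVlt => /predU1P[->|]; last first.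
      by move: n; near: x.
    by near: x; exact: nbhs_right_le.
  pose N := (Num.truncn A).+1.
  near=> x.
  have x_gt0 : 0 < x by near: x; exact: nbhs_right_gt.
  have xt n : (n < N)%N -> x <= t_ n by move: n; near: x; exact: near_t.
  have xN : x <= N%:R^-1.
    by near: x; apply: nbhs_right_le; rewrite invr_gt0 ltr0n.
  have NK : (N <= K x)%N.
    rewrite leqW// truncn_ge_nat ?invr_ge0 1?(ltW x_gt0)//.
    by rewrite -[leLHS]invrK lef_pV2 ?posrE ?invr_gt0 ?ltr0n.
  have Nc : (N <= c x)%N.
    rewrite /c (big_cat_nat _ NK)//= (leq_trans _ (leq_addr _ _))//.
    rewrite -[leqLHS]subn0 -[leqLHS]muln1 -sum_nat_const_nat big_nat.
    rewrite [leqRHS]big_nat; apply: leq_sum => n /andP[_ nN].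
    by rewrite xt.
  rewrite (le_trans (ltW (truncnS_gt A)))// ler_nat.
  exact: leq_trans Nc (leqnSn _).
- pose D : set (lebesgueR R) := `]0, 1]%classic.
  have mD : measurable D by exact: lebesgueR_measurable_itv.
  pose u n := F \_ (`]0, t_ n]%classic : set (lebesgueR R)).
  have FD x : D x -> (0 <= F x)%E by rewrite /D/= in_itv/=; exact: F0.
  have u0 n x : D x -> (0 <= u n x)%E.
    by rewrite /u patchE; case: ifPn => // _; exact: FD.
  have mF : measurable_fun D F := measurable_int _ F_int.
  have mu n : measurable_fun D (u n).
    apply/measurable_restrict => //.
    by apply: measurable_funS mF => //; exact: subIsetl.
  have mh : measurable_fun D (fun x => ((c x).+1%:R)%:E : \bar R).
    apply: nonincreasing_itv_measurable => x y.
    rewrite !in_itv/= => /andP[x0 _] _ xy.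
    by rewrite lee_fin ler_nat ltnS c_ni.
  have su0 x : D x -> (0 <= \sum_(0 <= n <oo) u n x)%E.
    by move=> Dx; apply: nneseries_ge0 => n _ _; exact: u0.
  have msu : measurable_fun D (fun x => \sum_(0 <= n <oo) u n x)%E.
    by apply: ge0_emeasurable_sum => // n x Dx _; exact: u0.
  (* The multiplier at [x] is one plus a partial sum of the indicators of the
     intervals ]0, t_ n]. *)
  apply: (@le_lt_trans _ _
    (\int[m]_(x in D) (F x + \sum_(0 <= n <oo) u n x))%E).
    apply: (@ge0_le_integral _ _ _ m D mD).
    + by move=> x Dx; rewrite mule_ge0// FD.
    + exact: emeasurable_funM.
    + exact: emeasurable_funD.
    move=> x Dx; have Fx := FD _ Dx.
    have x0 : 0 < x by move: Dx; rewrite /D/= in_itv/= => /andP[].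
    rewrite -natr1 EFinD addeC ge0_muleDr// mule1 leeD2l//.
    rewrite natr_sum -sumEFin ge0_sume_distrr//.
    apply: le_trans (nneseries_lim_ge (K x) _); last by move=> n _ _; exact: u0.
    rewrite le_eqVlt; apply/predU1P; left; apply: eq_bigr => n _.
    rewrite /u patchE mem_setE in_itv/= x0/=.
    by case: ifPn => xt; rewrite ?mule1// mule0.
  rewrite ge0_integralD// integral_nneseries// lte_add_pinfty ?integrable_lty//.
  apply: (@le_lt_trans _ _ 1%:E); last exact: ltry.
  apply: le_trans (@epsilon_trick0 R 1 xpredT ler01).
  apply: lee_nneseries => [n _ _|n _].
    by apply: integral_ge0 => x; exact: u0.
  by rewrite -integral_mkcondr.
Unshelve. all: by end_near. Qed.

(** Since [h] is nonincreasing, integrating [h s * w s >= h t * w s] over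
]0, t] bounds the quotient of the primitives by [1 / h t]. *)
Lemma weight_ll_mul (R : realType) (w h : R -> R) :
  weight w -> weight (fun t => w t * h t) ->
  {in `]0, 1] &, nonincreasing_fun h} -> h t @[t --> 0^'+] --> +oo ->
  weight_ll w (fun t => w t * h t).
Proof.
move=> [w_gt0 _ w_int] [v_gt0 _ v_int] h_ni h_oo.
apply: (@squeeze_cvgr _ (0^'+) _ R (cst 0) (fun t => (h t)^-1)); last 2 first.
- exact: cvg_cst.
- by apply/gtr0_cvgV0 => //; exact: (cvgry_gt h_oo 0).
near=> t.
have t_gt0 : 0 < t by near: t; exact: nbhs_right_gt.
have t_le1 : t <= 1 by near: t; exact: nbhs_right_le.
have ht_gt0 : 0 < h t by near: t; exact: (cvgry_gt h_oo 0).
have sub_t : `]0, t]%classic `<=` `]0, 1]%classic.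
  by move=> s /=; rewrite !in_itv/= => /andP[-> /le_trans]; apply.
have in_t s : `]0, t]%classic s -> s \in `]0, 1] by move/sub_t.
pose Dt : set (lebesgueR R) := `]0, t]%classic.
have wt_int : m.-integrable Dt (EFin \o w) by apply: (integrableS _ _ _ w_int).
have vt_int : m.-integrable Dt (EFin \o (fun t => w t * h t)).
  by apply: (integrableS _ _ _ v_int).
have W_ge0 : 0 <= primitive w t.
  by apply: Rintegral_ge0 => s /in_t/w_gt0/ltW.
have WV : h t * primitive w t <= primitive (fun t => w t * h t) t.
  rewrite /primitive -RintegralZl//; apply: le_Rintegral => //.
    by apply: (integrableZl _ (h t)) wt_int.
  move=> s Ds; rewrite mulrC ler_pM2l ?w_gt0 ?in_t//.
  apply: h_ni; [exact: in_t| by rewrite in_itv/= t_gt0|].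
  by move: Ds; rewrite /= in_itv/= => /andP[].
have V_ge0 : 0 <= primitive (fun t => w t * h t) t.
  by rewrite (le_trans _ WV)// mulr_ge0// ltW.
rewrite divr_ge0//=.
(* When the larger primitive is 0, the quotient is 0 by convention. *)
move: V_ge0; rewrite le_eqVlt => /predU1P[<-|V_gt0].
  by rewrite invr0 mulr0 invr_ge0 ltW.
by rewrite ler_pdivrMr// ler_pdivlMl.
Unshelve. all: by end_near. Qed.

Theorem theorem3p5 (R : realType) (phi : R -> R) (w : R -> R)
    (phi_orlicz : orlicz_function phi) (phi_Delta2 : Delta2_infty phi)
    (w_weight : weight w) :
  orlicz_lorentz phi w `\`
    \bigcup_(v in [set v : R -> R | weight v /\ weight_ll w v])
      orlicz_lorentz phi v
  = set0.
Proof.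
apply/seteqP; split => // f [[k k_gt0 fw_fin]]; apply.
have [w_gt0 w_ni w_int] := w_weight.
pose D : set (lebesgueR R) := `]0, 1]%classic.
pose G t := er_map phi (rearrangement (fun s => k * aqEqMfun_to_fun f s) t).
have G_ge0 t : (0 <= G t)%E by exact: er_map_orlicz_ge0 (rearrangement_ge0 _ _).
have mG : measurable_fun D G.
  apply: nonincreasing_itv_measurable => x y _ _ xy.
  apply: er_map_orlicz_le => //; first exact: rearrangement_ge0.
  exact: rearrangement_nonincreasing.
have mD : measurable D by exact: lebesgueR_measurable_itv.
have mw : measurable_fun D (EFin \o w) := measurable_int _ w_int.
have w_ge0 t : D t -> (0 <= (w t)%:E)%E.
  by move=> Dt; rewrite lee_fin ltW ?w_gt0.
(* [F] dominates both [w] and [G w], so that the integrability of [F h] controls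
   at once the integrability of [w h] and the modular with weight [w h]. *)
pose F t := ((w t)%:E + G t * (w t)%:E)%E.
have mGw : measurable_fun D (fun t => G t * (w t)%:E)%E.
  exact: emeasurable_funM.
have Gw_int : m.-integrable D (fun t => G t * (w t)%:E)%E.
  apply/integrableP; split => //.
  rewrite (_ : (\int[m]_(t in D) _)%E
    = modular phi w (fun s => k * aqEqMfun_to_fun f s))//.
  apply: eq_integral => t /set_mem Dt.
  by rewrite gee0_abs// mule_ge0// w_ge0.
have F_int : m.-integrable D F by exact: integrableD.
have F_ge0 t : D t -> (0 <= F t)%E.
  by move=> Dt; rewrite adde_ge0 ?mule_ge0 ?w_ge0.
have [h [h_ge1 h_ni h_oo Fh_fin]] := exists_blowup_multiplier F_int F_ge0.
have h_ge0 t : 0 <= h t by exact: le_trans (h_ge1 t).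
have h_gt0 t : 0 < h t by exact: lt_le_trans (h_ge1 t).
have mh : measurable_fun D (EFin \o h).
  by apply: nonincreasing_itv_measurable => x y xD yD xy; rewrite lee_fin h_ni.
pose v t := w t * h t.
have mv : measurable_fun D (EFin \o v) := emeasurable_funM mw mh.
have mFh : measurable_fun D (fun t => F t * (h t)%:E)%E.
  by apply: emeasurable_funM => //; exact: measurable_int F_int.
have v_gt0 : {in `]0, 1], forall t, 0 < v t}.
  by move=> t Dt; rewrite mulr_gt0 ?w_gt0.
have v_weight : weight v.
  split => //.
    move=> x y Dx Dy xy; apply: ler_pM => //; [|exact: w_ni|exact: h_ni].
    by rewrite ltW ?w_gt0.
  apply/integrableP; split => //; apply: le_lt_trans Fh_fin.
  apply: (@ge0_le_integral _ _ _ m D mD);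
    [by []|exact: measurableT_comp|exact: mFh|].
  move=> t Dt /=; rewrite gtr0_norm ?v_gt0// EFinM lee_wpmul2r ?lee_fin//.
  by rewrite leeDl// mule_ge0// w_ge0.
exists v; first by split => //; exact: weight_ll_mul.
exists k => //; apply: le_lt_trans Fh_fin.
apply: (@ge0_le_integral _ _ _ m D mD).
- move=> t Dt; apply: mule_ge0; first exact: G_ge0.
  by rewrite lee_fin ltW// v_gt0.
- exact: emeasurable_funM.
- exact: mFh.
move=> t Dt; rewrite EFinM muleA lee_wpmul2r ?lee_fin//.
by rewrite leeDr// w_ge0.
Qed.
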